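(* Let $p$ be an odd prime. The smallest order of a $p$-group $P$ of nilpotency class two, rank seven and exponent $p$ such that $A(P) = Z(\mathrm{GL}(7,p))\,G_2(p)$ is $p^{14}$.
   Context: For a finite $p$-group $P$, the rank $d$ of $P$ is the minimum size of a generating set of $P$, and $\Phi(P)$ is its Frattini subgroup. The quotient $P/\Phi(P)$ is identified (by a choice of basis) with $\mathbb{F}_p^d$. Restriction gives a natural homomorphism $\theta: \mathrm{Aut}(P) \to \mathrm{Aut}(P/\Phi(P)) \cong \mathrm{GL}(d,p)$, and $A(P) \le \mathrm{GL}(d,p)$ denotes the image of $\theta$, i.e. the group induced by $\mathrm{Aut}(P)$ on $P/\Phi(P)$ (well defined up to conjugacy in $\mathrm{GL}(d,p)$). For $q$ a power of an odd prime, $G_2(q) := \mathrm{Aut}(\mathbb{O})$, where $\mathbb{O}$ is the octonion algebra over $\mathbb{F}_q$: the eight-dimensional algebra with basis $\{1,i_0,\ldots,i_6\}$ in which $1$ is the identity, $i_t^2=-1$, $i_s i_t = -i_t i_s$ for $s\neq t$, and $i_t i_{t+1}=i_{t+3}$, $i_{t+1}i_{t+3}=i_t$, $i_{t+3}i_t=i_{t+1}$ for each $t\in\mathbb{Z}/7\mathbb{Z}$ (subscripts modulo seven). The group $G_2(p)$ is regarded as a subgroup of $\mathrm{GL}(7,p)$ via an irreducible seven-dimensional $\mathbb{F}_p$-representation (for instance its action on the span of $i_0,\ldots,i_6$); the images of all such representations are conjugate in $\mathrm{GL}(7,p)$. $Z(\mathrm{GL}(7,p))$ is the group of nonzero scalar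 matrices. *)

(* Defs.v *)
From HB Require Import structures.
From mathcomp Require Import all_boot all_order all_algebra.
From mathcomp Require Import all_fingroup all_solvable.

Set Implicit Arguments.
Unset Strict Implicit.
Unset Printing Implicit Defensive.

Import GRing.Theory.
Local Open Scope ring_scope.

Section Octonions.

Variable F : finFieldType.

Definition oct1 : 'rV[F]_(1 + 7) := delta_mx 0 (lshift 7 ord0).
Definition octi (t : 'Z_7) : 'rV[F]_(1 + 7) := delta_mx 0 (rshift 1 t).

Definition octre (x : 'rV[F]_(1 + 7)) : F := x 0 (lshift 7 ord0).
Definition octim (x : 'rV[F]_(1 + 7)) (t : 'Z_7) : F := x 0 (rshift 1 t).

(* The last sum collects, for each t modulo 7, the contributions of
     i_t i_(t+1) = i_(t+3),  i_(t+1) i_(t+3) = i_t,  i_(t+3) i_t = i_(t+1)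
   and of the same products with the two factors exchanged.                   *)
Definition octmul (x y : 'rV[F]_(1 + 7)) : 'rV[F]_(1 + 7) :=
  (octre x * octre y - \sum_(t : 'Z_7) octim x t * octim y t) *: oct1
  + \sum_(t : 'Z_7) (octre x * octim y t + octim x t * octre y) *: octi t
  + \sum_(t : 'Z_7)
      ((octim x t * octim y (t + 1) - octim x (t + 1) * octim y t)
         *: octi (t + 3%:R)
       + (octim x (t + 1) * octim y (t + 3%:R)
          - octim x (t + 3%:R) * octim y (t + 1)) *: octi t
       + (octim x (t + 3%:R) * octim y t - octim x t * octim y (t + 3%:R))
         *: octi (t + 1)).

Lemma octmul_linearl a x y z :
  octmul (a *: x + y) z = a *: octmul x z + octmul y z.
Proof.
have Er : octre (a *: x + y) = a * octre x + octre y by rewrite /octre !mxE.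
have Ei t : octim (a *: x + y) t = a * octim x t + octim y t.
  by rewrite /octim !mxE.
rewrite /octmul Er !scalerDr !scaler_sumr scalerA.
rewrite [RHS]addrACA -!big_split /=.
rewrite [X in _ = X + _]addrACA -scalerDl -big_split /=.
congr (_ *: _ + _ + _).
- under eq_bigr do rewrite Ei mulrDl -mulrA.
  by rewrite big_split /= -mulr_sumr mulrDl -mulrA opprD addrACA mulrBr.
- apply: eq_bigr => t _; rewrite Ei !scalerA -scalerDl; congr (_ *: _).
  by rewrite !mulrDl mulrDr !mulrA addrACA.
- apply: eq_bigr => t _; rewrite !Ei !scalerDr !scalerA.
  rewrite [RHS]addrACA [X in _ = X + _]addrACA -!scalerDl.
  by congr (_ *: _ + _ *: _ + _ *: _);
     rewrite !mulrDl !mulrBr !mulrA opprD addrACA.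
Qed.

Lemma octmul_linearr a x y z :
  octmul z (a *: x + y) = a *: octmul z x + octmul z y.
Proof.
have Er : octre (a *: x + y) = a * octre x + octre y by rewrite /octre !mxE.
have Ei t : octim (a *: x + y) t = a * octim x t + octim y t.
  by rewrite /octim !mxE.
rewrite /octmul Er !scalerDr !scaler_sumr scalerA.
rewrite [RHS]addrACA -!big_split /=.
rewrite [X in _ = X + _]addrACA -scalerDl -big_split /=.
congr (_ *: _ + _ + _).
- under eq_bigr do rewrite Ei mulrDr mulrCA.
  by rewrite big_split /= -mulr_sumr mulrDr mulrCA opprD addrACA mulrBr.
- apply: eq_bigr => t _; rewrite Ei !scalerA -scalerDl; congr (_ *: _).
  by rewrite !mulrDr mulrCA [octim z t * (a * _)]mulrCA addrACA.
- apply: eq_bigr => t _; rewrite !Ei !scalerDr !scalerA.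
  rewrite [RHS]addrACA [X in _ = X + _]addrACA -!scalerDl.
  by congr (_ *: _ + _ *: _ + _ *: _);
     rewrite !mulrDr !mulrN ![_ * (a * _)]mulrCA opprD addrACA.
Qed.

Let octre1 : octre oct1 = 1. Proof. by rewrite /octre !mxE !eqxx. Qed.
Let octim1 t : octim oct1 t = 0.
Proof. by rewrite /octim !mxE eq_rlshift. Qed.
Let octrei t : octre (octi t) = 0.
Proof. by rewrite /octre !mxE eq_lrshift. Qed.
Let octimi s t : octim (octi s) t = (t == s)%:R.
Proof. by rewrite /octim !mxE eqxx eq_rshift. Qed.

Let octE x : x = octre x *: oct1 + \sum_t octim x t *: octi t.
Proof.
rewrite {1}[x]row_sum_delta big_split_ord big_ord1 /=; congr (_ + _).
Qed.

Lemma oct1mul : left_id oct1 octmul.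
Proof.
move=> x; rewrite {2}[x]octE /octmul octre1 mul1r.
under eq_bigr do rewrite octim1 mul0r.
under [X in _ + X + _]eq_bigr do rewrite octim1 mul0r mul1r addr0.
under [X in _ + X]eq_bigr do rewrite !octim1 !mul0r subr0 !scale0r !addr0.
by rewrite !big1_eq subr0 addr0.
Qed.

Lemma octmul1 : right_id oct1 octmul.
Proof.
move=> x; rewrite {2}[x]octE /octmul octre1 mulr1.
under eq_bigr do rewrite octim1 mulr0.
under [X in _ + X + _]eq_bigr do rewrite octim1 mulr0 mulr1 add0r.
under [X in _ + X]eq_bigr do rewrite !octim1 !mulr0 subr0 !scale0r !addr0.
by rewrite !big1_eq subr0 addr0.
Qed.

Let octmulii s t : octmul (octi s) (octi t) =
  - (s == t)%:R *: oct1
  + \sum_(u : 'Z_7)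
      (((u == s)%:R * (u + 1 == t)%:R - (u + 1 == s)%:R * (u == t)%:R)
         *: octi (u + 3%:R)
       + ((u + 1 == s)%:R * (u + 3%:R == t)%:R
          - (u + 3%:R == s)%:R * (u + 1 == t)%:R) *: octi u
       + ((u + 3%:R == s)%:R * (u == t)%:R - (u == s)%:R * (u + 3%:R == t)%:R)
         *: octi (u + 1)).
Proof.
rewrite /octmul !octrei mul0r sub0r -addrA; congr (_ *: _ + _).
  congr (- _); rewrite (bigD1 s) //= !octimi eqxx mul1r big1 ?addr0 //.
  by move=> u /negPf us; rewrite octimi us mul0r.
rewrite big1 ?add0r => [|u _]; last by rewrite mul0r mulr0 addr0 scale0r.
by apply: eq_bigr => u _; rewrite !octimi.
Qed.

Lemma octi_sqr t : octmul (octi t) (octi t) = - oct1.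
Proof.
have comm0 (a b : F) : a * b - b * a = 0 by rewrite mulrC subrr.
by rewrite octmulii eqxx scaleN1r big1 ?addr0 // => u _;
   rewrite !comm0 !scale0r !addr0.
Qed.

Lemma octi_anticomm s t :
  s != t -> octmul (octi s) (octi t) = - octmul (octi t) (octi s).
Proof.
rewrite !octmulii [t == s]eq_sym => /negPf->.
rewrite oppr0 !scale0r !add0r -sumrN; apply: eq_bigr => u _.
rewrite !opprD -!scaleNr !opprB.
by congr (_ *: _ + _ *: _ + _ *: _); congr (_ - _); rewrite mulrC.
Qed.

Let octmul_shift t a b : octmul (octi (t + a)) (octi (t + b)) =
  - (a == b)%:R *: oct1
  + \sum_(u : 'Z_7)
      (((u == a)%:R * (u + 1 == b)%:R - (u + 1 == a)%:R * (u == b)%:R)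
         *: octi (t + (u + 3%:R))
       + ((u + 1 == a)%:R * (u + 3%:R == b)%:R
          - (u + 3%:R == a)%:R * (u + 1 == b)%:R) *: octi (t + u)
       + ((u + 3%:R == a)%:R * (u == b)%:R - (u == a)%:R * (u + 3%:R == b)%:R)
         *: octi (t + (u + 1))).
Proof.
rewrite octmulii (inj_eq (addrI t)) (reindex_inj (addrI t)) /=.
by under eq_bigr => u _ do rewrite -!(addrA t) !(inj_eq (addrI t)).
Qed.

Let simp01 := (mulr0, mul0r, mulr1, subrr, subr0, oppr0, scale0r, scale1r,
  addr0, add0r).

Lemma octi_mul_0_1 t : octmul (octi t) (octi (t + 1)) = octi (t + 3%:R).
Proof.
by rewrite -{1}[t]addr0 octmul_shift !big_ord_recl big_ord0 /= !simp01;
   congr (octi (t + _)); apply: val_inj.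
Qed.

Lemma octi_mul_1_3 t : octmul (octi (t + 1)) (octi (t + 3%:R)) = octi t.
Proof.
by rewrite octmul_shift !big_ord_recl big_ord0 /= !simp01.
Qed.

Lemma octi_mul_3_0 t : octmul (octi (t + 3%:R)) (octi t) = octi (t + 1).
Proof.
by rewrite -{2}[t]addr0 octmul_shift !big_ord_recl big_ord0 /= !simp01;
   congr (octi (t + _)); apply: val_inj.
Qed.

(* The algebra automorphisms of the octonions, as matrices acting on row
   vectors in the basis oct1, octi 0, ..., octi 6.                            *)
Definition G2 : {set {'GL_8[F]}} :=
  [set g : {'GL_8[F]} | [forall x : 'rV[F]_(1 + 7), forall y,
    octmul x y *m GLval g == octmul (x *m GLval g) (y *m GLval g)]].

(* The image of G2 in GL(7) under its action on the span of the octi t.       *)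
Definition G2_7 : {set {'GL_7[F]}} :=
  [set M : {'GL_7[F]} | [exists g in G2, forall v : 'rV[F]_7,
    row_mx (0 : 'rV[F]_1) v *m GLval g
      == row_mx (0 : 'rV[F]_1) (v *m GLval M)]].

End Octonions.

Local Open Scope group_scope.

Section InducedGroup.

Variables (p n : nat) (gT : finGroupType) (P : {group gT}).

Local Notation d := n.+1.

(* The image of Aut P -> Aut (P / 'Phi(P)), transported to GL(d, p) along an
   identification f of P / 'Phi(P) with the row vectors of length d; matrices
   act on the right, matching the left-to-right composition of permutations.  *)
Definition induced_group (f : {morphism P / 'Phi(P) >-> 'rV['F_p]_d}) :
    {set {'GL_d['F_p]}} :=
  [set M : {'GL_d['F_p]} | [exists a in Aut P, forall x in P,
    f (coset 'Phi(P) (a x)) == f (coset 'Phi(P) x) *m GLval M]].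

(* A(P) = H, where A(P) is only defined up to conjugacy in GL(d, p).          *)
Definition induces (H : {set {'GL_d['F_p]}}) : Prop :=
  exists f : {morphism P / 'Phi(P) >-> 'rV['F_p]_d},
    isom (P / 'Phi(P)) [set: 'rV['F_p]_d] f
    /\ induced_group f \in H :^: 'GL_d['F_p].

End InducedGroup.

Definition class2_rank7_exponent_p_inducing_ZG2
    (p : nat) (gT : finGroupType) (P : {group gT}) : Prop :=
  [/\ p.-group P, nil_class P = 2%N, 'm(P) = 7%N, exponent P = p
    & induces P ('Z('GL_7(p)) * G2_7 'F_p)].

(* Main.v *)
Require Import Defs.
From HB Require Import structures.
From mathcomp Require Import all_boot all_order all_algebra.
From mathcomp Require Import all_fingroup all_solvable.
From mathcomp Require Import ring.

(** Let [V] be the span of the [i_t], and let [v x w] be the imaginary part of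
    the octonion product, so that [v x (v x w) = <v,w> v - <v,v> w].

    Order [p^14] is attained by [V * V] with
    [(v,a)(w,b) = (v + w, a + b + v x w)]: a matrix [M] is induced by an
    automorphism iff [vM x wM = (v x w)N] for some invertible [N]. Given such
    [M] and [N], the matrices [ad v] of [w |-> v x w] satisfy
    [M ad(vM) = ad(v) N]. Since [ad v] has rank at least 6 exactly when
    [<v,v> != 0], [M] preserves isotropy, which forces [M M^T] to be scalar.
    Moreover [ad v] kills [N M^T v^T], so [v^T] is an eigenvector of [N M^T]
    whenever [<v,v> != 0], and [N M^T] is scalar too. Hence [N = c M], and
    [M / c] is an automorphism of the cross product, so lies in [G2].

    For the lower bound, the sign changes and the index shift in [G2] generate
    a group [2^3 : 7]. The seven weights of [2^3] on the commutators of lifts of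
    the [i_t] are permuted transitively by the shift, so every one of them
    occurs in the derived subgroup, whose order is therefore at least [p^7]. *)

Set Implicit Arguments.
Unset Strict Implicit.
Unset Printing Implicit Defensive.

Import GRing.Theory.
Local Open Scope ring_scope.

(** [ring] treats coordinates such as [v 0 (u + i%:R)] as atoms, so nested index offsets must first
    be reduced modulo 7 to a common form. *)
Lemma Z7_addnD (u : 'Z_7) (i j k : nat) :
  ((i + j) %% 7 = k %% 7)%N -> u + i%:R + j%:R = u + k%:R.
Proof.
by move=> ijk; rewrite -addrA -natrD; congr (u + _); apply: val_inj;
   rewrite /= !val_Zp_nat.
Qed.

Ltac Z7_norm := rewrite /=; repeat match goal with
  |- context [?u + ?i%:R + ?j%:R] =>
    let k := eval vm_compute in ((i + j) %% 7)%N in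
    rewrite !(@Z7_addnD u i j k erefl)
  end.

(** * The cross product of imaginary octonions and the rank of its matrices *)

Section CrossProduct.

Variable F : finFieldType.
Implicit Types (v w x : 'rV[F]_7) (M N : 'M[F]_7).

Definition minor v w (s t : 'Z_7) : F := v 0 s * w 0 t - v 0 t * w 0 s.

(** One minor for each of the three Fano lines through [u], oriented so that the product of the
    other two points is [i_u]. *)
Definition cross_coord v w (u : 'Z_7) : F :=
  minor v w (u + 1%:R) (u + 3%:R) + minor v w (u + 2%:R) (u + 6%:R)
    + minor v w (u + 4%:R) (u + 5%:R).

Definition cross v w : 'rV[F]_7 := \row_(u < 7) cross_coord v w u.

Definition dot v w : F := \sum_(t : 'Z_7) v 0 t * w 0 t.

Lemma crossE v w (u : 'Z_7) : cross v w 0 u = cross_coord v w u.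
Proof. by rewrite mxE. Qed.

(** The expansion starts at an arbitrary [u] so that its terms match the atoms in the [u]-th
    coordinate of a cross product. *)
Lemma dotE v w (u : 'Z_7) : dot v w =
  v 0 (u + 0%:R) * w 0 (u + 0%:R) + v 0 (u + 1%:R) * w 0 (u + 1%:R)
  + v 0 (u + 2%:R) * w 0 (u + 2%:R) + v 0 (u + 3%:R) * w 0 (u + 3%:R)
  + v 0 (u + 4%:R) * w 0 (u + 4%:R) + v 0 (u + 5%:R) * w 0 (u + 5%:R)
  + v 0 (u + 6%:R) * w 0 (u + 6%:R).
Proof.
have vw (i j : 'Z_7) : val i = val j ->
    v 0 (u + i) * w 0 (u + i) = v 0 (u + j) * w 0 (u + j).
  by move/val_inj=> ->.
rewrite /dot (reindex_inj (addrI u)) /= !big_ord_recl big_ord0 -!addrA.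
congr (_ + _); do 5![congr (_ + _); first exact: vw].
by rewrite addr0; apply: vw.
Qed.

Lemma dotC v w : dot v w = dot w v.
Proof. by apply: eq_bigr => t _; rewrite mulrC. Qed.

Lemma dotDl v w x : dot (v + w) x = dot v x + dot w x.
Proof.
by rewrite /dot -big_split; apply: eq_bigr => t _; rewrite mxE mulrDl.
Qed.

Lemma dotZl a v w : dot (a *: v) w = a * dot v w.
Proof. by rewrite /dot mulr_sumr; apply: eq_bigr => t _; rewrite mxE mulrA. Qed.

Lemma dotDr v w x : dot x (v + w) = dot x v + dot x w.
Proof. by rewrite dotC dotDl !(dotC x). Qed.

Lemma dotZr a v w : dot v (a *: w) = a * dot v w.
Proof. by rewrite dotC dotZl dotC. Qed.

Lemma dot_delta s t : dot (delta_mx 0 s) (delta_mx 0 t) = (s == t)%:R.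
Proof.
rewrite /dot (bigD1 s) //= !mxE !eqxx /= mul1r big1 ?addr0 // => u us.
by rewrite !mxE (negPf us) mul0r.
Qed.

Lemma crossC v w : cross v w = - cross w v.
Proof. by apply/rowP => u; rewrite !mxE /cross_coord /minor; ring. Qed.

Lemma crossvv v : cross v v = 0.
Proof. by apply/rowP => u; rewrite !mxE /cross_coord /minor; ring. Qed.

Lemma crossZZ a b v w : cross (a *: v) (b *: w) = (a * b) *: cross v w.
Proof. by apply/rowP => u; rewrite !mxE /cross_coord /minor !mxE; ring. Qed.

Lemma crossDl v w x : cross (v + w) x = cross v x + cross w x.
Proof. by apply/rowP => u; rewrite !mxE /cross_coord /minor !mxE; ring. Qed.

Lemma crossDr v w x : cross x (v + w) = cross x v + cross x w.
Proof. by apply/rowP => u; rewrite !mxE /cross_coord /minor !mxE; ring. Qed.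

Lemma crossZr a v w : cross v (a *: w) = a *: cross v w.
Proof. by rewrite -{1}[v]scale1r crossZZ mul1r. Qed.

Lemma crossZl a v w : cross (a *: v) w = a *: cross v w.
Proof. by rewrite -{1}[w]scale1r crossZZ mulr1. Qed.

Lemma cross0v v : cross 0 v = 0.
Proof. by rewrite -(scale0r 0) crossZl !scale0r. Qed.

(** This is the imaginary part of the alternative law x(xy) = (xx)y, checked as a polynomial
    identity in each coordinate. *)
Lemma cross_cross v w : cross v (cross v w) = dot v w *: v - dot v v *: w.
Proof.
have u0 (u : 'Z_7) : u = u + 0%:R by rewrite addr0.
apply/rowP => u.
rewrite !(dotE _ _ u) crossE !mxE {1}/cross_coord /minor !crossE /cross_coord
  /minor.
rewrite [in X in _ = X](u0 u).
Z7_norm.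
by ring.
Qed.

Lemma dot_cross v w : dot v (cross v w) = 0.
Proof.
rewrite (dotE _ _ 0) !crossE /cross_coord /minor; Z7_norm.
by ring.
Qed.

Lemma octmul_row_mx (a b : F) v w :
  octmul (row_mx (a%:M : 'M_1) v) (row_mx (b%:M : 'M_1) w) =
  row_mx ((a * b - dot v w)%:M : 'M_1) (a *: w + b *: v + cross v w).
Proof.
have re c x : octre (row_mx (c%:M : 'M_1) x) = c.
  by rewrite /octre row_mxEl mxE eqxx mulr1n.
have im c x t : octim (row_mx (c%:M : 'M_1) x) t = x 0 t.
  by rewrite /octim row_mxEr.
have i0 t : octi F t 0 (lshift 7 0) = 0 by rewrite mxE eq_lrshift andbF.
have ir s t : octi F s 0 (rshift 1 t) = (t == s)%:R.
  by rewrite mxE eqxx eq_rshift.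
have entry n (a1 a2 a3 : F) (x1 x2 x3 : 'rV[F]_n) i k :
    (a1 *: x1 + a2 *: x2 + a3 *: x3) i k =
    a1 * x1 i k + a2 * x2 i k + a3 * x3 i k.
  by rewrite !mxE.
have entry1 n (a1 : F) (x1 x2 x3 : 'rV[F]_n) i k :
    (a1 *: x1 + x2 + x3) i k = a1 * x1 i k + x2 i k + x3 i k.
  by rewrite !mxE.
apply/rowP => j; case: (split_ordP j) => {}j ->.
  rewrite (ord1 j) /octmul row_mxEl !re entry1 !summxE.
  rewrite [X in _ + X + _]big1 => [|t _]; last by rewrite mxE i0 mulr0.
  rewrite [X in _ + X]big1 => [|t _]; last by rewrite entry !i0 !mulr0 !addr0.
  rewrite [oct1 _ _ _]mxE !eqxx mulr1 !addr0 [RHS]mxE eqxx mulr1n.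
  by under eq_bigr do rewrite !im.
rewrite /octmul row_mxEr -[cross v w]scale1r entry entry1 mul1r !re.
rewrite [oct1 _ _ _]mxE eq_rlshift andbF mulr0 add0r !summxE.
(* Only the index [t] with [g t = j] contributes to coordinate [j]. *)
have pick (f : 'Z_7 -> F) (g h : 'Z_7 -> 'Z_7) :
    cancel g h -> cancel h g ->
  \sum_t f t * octi F (g t) 0 (rshift 1 j) = f (h j).
  move=> gK hK; rewrite (bigD1 (h j)) //= ir hK eqxx mulr1 big1 ?addr0 // =>
    t tj.
  by rewrite ir; case: eqP => [jt|_];
    [rewrite jt gK eqxx in tj | rewrite mulr0].
congr (_ + _).
  under eq_bigr do rewrite mxE !im; rewrite (pick _ id id) //.
  by congr (_ + _); rewrite mulrC.
under eq_bigr => t _ do rewrite entry !im.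
rewrite !big_split /= (pick _ (fun t => t + 3%:R) (fun t => t - 3%:R));
  first 1 last.
- exact: addrK.
- exact: subrK.
rewrite (pick _ id id) // (pick _ (fun t => t + 1) (fun t => t - 1));
  first 1 last.
- exact: addrK.
- exact: subrK.
have shift (k l : 'Z_7) (i : nat) : val (k + l) = (i %% 7)%N ->
    j + k + l = j + i%:R :> 'Z_7.
  by move=> h; rewrite -addrA; congr (j + _); apply: val_inj;
    apply: etrans h (esym (val_Zp_nat _ _)).
have shift0 (k : 'Z_7) (i : nat) : val k = (i %% 7)%N ->
    j + k = j + i%:R :> 'Z_7.
  by move=> h; congr (j + _); apply: val_inj;
    apply: etrans h (esym (val_Zp_nat _ _)).
rewrite (shift (- 3%:R) 1 5%N) // (shift (- 1) 3%:R 2%N) //.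
rewrite (shift0 (- 3%:R) 4%N) // (shift0 (- 1) 6%N) //.
by rewrite crossE /cross_coord /minor; ring.
Qed.

HB.instance Definition _ v := GRing.isLinear.Build F _ _ _ (cross v)
  (fun a x y => etrans (crossDr (a *: x) y v) (congr1 (+%R^~ _) (crossZr a v
    x))).

Definition ad v : 'M[F]_7 := lin1_mx (cross v).

Lemma mul_ad v w : w *m ad v = cross v w.
Proof. by rewrite mul_rV_lin1. Qed.

Lemma dot_mxE v w : v *m w^T = (dot v w)%:M.
Proof.
apply/matrixP => i j; rewrite !ord1 !mxE eqxx mulr1n.
by apply: eq_bigr => t _; rewrite mxE.
Qed.

Lemma row_mulmx_inj m (A B : 'M[F]_(7, m)) :
  (forall w, w *m A = w *m B) -> A = B.
Proof. by move=> AB; apply/row_matrixP => i; rewrite !rowE. Qed.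

Lemma ad_sqr v : ad v *m ad v = v^T *m v - (dot v v)%:M.
Proof.
apply: row_mulmx_inj => w; rewrite !mulmxA !mul_ad cross_cross mulmxBr mulmxA.
by rewrite dot_mxE mul_scalar_mx mul_mx_scalar dotC.
Qed.

(** Here the square of [ad v] is [v^T *m v], of rank at most 1, so Sylvester's inequality bounds
    twice the rank of [ad v] by 1 + 7. *)
Lemma rank_ad_isotropic v : dot v v = 0 -> (\rank (ad v) < 6)%N.
Proof.
move=> v0; have := mxrank_mul_min (ad v) (ad v).
rewrite ad_sqr v0 raddf0 subr0 => le1.
have {le1} := leq_trans le1 (leq_trans (mxrankM_maxr _ _) (rank_leq_row _)).
by case: (\rank (ad v)) => [|[|[|[|[|[|]]]]]] // r;
  rewrite !addSn !addnS !subSS subn0.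
Qed.

(** By [ad_sqr], an invertible scalar matrix is the sum of a matrix of rank at most 1 and a multiple
    of the square of [ad v], so 7 is at most [1 + \rank (ad v)]. *)
Lemma rank_ad_anisotropic v : dot v v != 0 -> (6 <= \rank (ad v))%N.
Proof.
move=> v0; have: \rank ((dot v v)%:M : 'M[F]_7) = 7.
  by apply: mxrank_unit; rewrite unitmxE det_scalar unitrX ?unitfE.
have -> : (dot v v)%:M = v^T *m v + - (ad v *m ad v) :> 'M[F]_7.
  by rewrite ad_sqr opprB addrC subrK.
move=> r7; have := mxrank_add (v^T *m v) (- (ad v *m ad v)).
rewrite r7 -[- _]scaleN1r mxrank_scale_nz ?oppr_eq0 ?oner_eq0 // => h.
have := leq_trans h (leq_add (leq_trans (mxrankM_maxr _ _) (rank_leq_row _))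
  (mxrankM_maxr _ _)).
by rewrite add1n ltnS.
Qed.

End CrossProduct.

Lemma Z7_notin (l : seq 'Z_7) : (size l < 7)%N -> exists u, u \notin l.
Proof.
move=> l7; apply/existsP; apply: contraLR l7; rewrite negb_exists -leqNgt.
move=> /forallP/= lT; apply: leq_trans (card_size l).
apply: leq_trans (_ : #|'Z_7| <= _)%N; first by rewrite card_ord.
by apply: subset_leq_card; apply/subsetP => u _; have := lT u; rewrite negbK.
Qed.

(** * Minus one as a sum of two squares *)

Section SumOfSquares.

Variable F : finFieldType.
Hypothesis odd_F : odd #|F|.

(* Squaring is at most two-to-one, and [#|F|] is odd. *)
Lemma card_sqr_image : (#|F| < 2 * #|[set x ^+ 2 | x : F]|)%N.
Proof.
suff: (#|F| <= 2 * #|[set x ^+ 2 | x : F]|)%N.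
  rewrite leq_eqVlt => /orP[/eqP FE|//].
  by move: odd_F; rewrite FE mul2n odd_double.
rewrite mulnC -sum_nat_const -sum1_card (partition_big_imset (fun x : F => x ^+
  2)) /=.
apply: leq_sum => y /imsetP[a _ ->].
rewrite sum1dep_card; apply: leq_trans (_ : #|[set a; - a]| <= 2)%N.
  by apply: subset_leq_card; apply/subsetP => x; rewrite !inE eqf_sqr.
by rewrite cards2; case: (_ != _).
Qed.

(** Pigeonhole: the squares [x] and the elements [- 1 - x] each fill more than half of the field, so
    the two sets meet. Not both roots vanish, and a swap makes [a] nonzero. *)
Lemma sum2sqr_eqN1 : exists a b : F, a != 0 /\ a ^+ 2 + b ^+ 2 = - 1.
Proof.
set A := [set x ^+ 2 | x : F]; set B := [set - 1 - x | x in A].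
have cB : #|B| = #|A| by apply: card_imset => x y /addrI/oppr_inj.
have [AB|/set0Pn[x /setIP[/imsetP[a _ ->] /imsetP[_ /imsetP[b _ ->] ab]]]] :=
  eqVneq (A :&: B) set0.
  have := cardsUI A B; rewrite AB cards0 addn0 cB => h2.
  have := max_card (mem (A :|: B)).
  by have := card_sqr_image; rewrite -/A mul2n -addnn -h2 ltnNge => /negPf->.
have {}ab : a ^+ 2 + b ^+ 2 = - 1 by rewrite ab subrK.
have [a0|a0] := eqVneq a 0; last by exists a, b.
exists b, a; rewrite addrC; split=> //; apply: contra_eq_neq ab => ->.
by rewrite a0 expr0n addr0 eq_sym oppr_eq0 oner_eq0.
Qed.

End SumOfSquares.

(** * Matrices compatible with the cross product *)

Section Similarity.

Variable F : finFieldType.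
Hypothesis odd_F : odd #|F|.
Implicit Types (v w x : 'rV[F]_7) (M N : 'M[F]_7).

Local Notation e s := (delta_mx 0 s : 'rV[F]_7).

Lemma two_neq0 : 2%:R != 0 :> F.
Proof.
apply/eqP => F2; have: (#[1%R : F]%g %| #|[set: F]|)%N by rewrite order_dvdG
  ?inE.
rewrite cardsT (@nt_prime_order _ 2) ?zmodXgE ?zmod1gE ?oner_eq0 //.
by rewrite dvdn2 odd_F.
Qed.

(** The basis vectors are anisotropic, which makes [X] diagonal; so are the sums [e i + e 0], of
    square length 2, which equates the diagonal entries. *)
Lemma scalar_of_eigen (X : 'M[F]_7) :
  (forall v, dot v v != 0 -> exists k, X *m v^T = k *: v^T) ->
  exists k, X = k%:M.
Proof.
move=> eigX.
have ev s : exists k, forall i, X i s = k * (i == s)%:R.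
  have [|k /matrixP kE] := eigX (e s);
    first by rewrite dot_delta eqxx oner_neq0.
  by exists k => i; have := kE i 0; rewrite trmx_delta -colE !mxE eqxx andbT.
have off i s : i != s -> X i s = 0.
  by have [k ->] := ev s; move=> /negPf->; rewrite mulr0.
exists (X 0 0); apply/matrixP => i j; rewrite [RHS]mxE.
have [<-|/off->//] := eqVneq i j; rewrite mulr1n.
have [-> //|i0] := eqVneq i 0.
have [|k /matrixP kE] := eigX (e i + e 0).
  by rewrite dotDl !dotDr !dot_delta !eqxx (eq_sym 0 i) (negPf i0) add0r addr0
    two_neq0.
have:= kE 0 0; have := kE i 0;
  rewrite linearD /= !trmx_delta mulmxDr -!colE !mxE.
rewrite !eqxx /= !(eq_sym 0) (negPf i0) (off i 0) // (off 0 i) 1?eq_sym //.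
by rewrite !(addr0, add0r) => -> ->.
Qed.

Section Semisimilarity.

Variables M N : 'M[F]_7.
Hypotheses (uM : M \in unitmx) (uN : N \in unitmx).
Hypothesis crossMN : forall v w, cross (v *m M) (w *m M) = cross v w *m N.

Lemma ad_mulmx v : M *m ad (v *m M) = ad v *m N.
Proof. by apply: row_mulmx_inj => w; rewrite !mulmxA !mul_ad crossMN. Qed.

Lemma isotropic_mulmx v : dot v v = 0 -> dot (v *m M) (v *m M) = 0.
Proof.
move=> /rank_ad_isotropic; apply: contraTeq => /rank_ad_anisotropic.
have <- : \rank (M *m ad (v *m M)) = \rank (ad (v *m M)).
  by rewrite eqmxMfull ?row_full_unit.
by rewrite ad_mulmx mxrankMfree ?row_free_unit // -leqNgt.
Qed.

(* The rows [m_s] of [M] give the Gram matrix [b]. The isotropic vectors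
   [e_s + a e_t + c e_u], with [(a, c) = (+-al, +-be)], make [b] diagonal by
   comparing signs and constant on the diagonal by varying [t]. *)
Lemma mulmx_tr_scalar : exists2 c, c != 0 & M *m M^T = c%:M.
Proof.
have two0 := two_neq0.
pose b (s t : 'Z_7) := dot (e s *m M) (e t *m M).
have bC s t : b s t = b t s by rewrite /b dotC.
have [al [be [al0 albe]]] := sum2sqr_eqN1 odd_F.
pose L s t u a c := b s s + a ^+ 2 * b t t + c ^+ 2 * b u u
  + 2%:R * (a * b s t + c * b s u + a * c * b t u).
have isoE s t u a c : s != t -> s != u -> t != u -> a ^+ 2 + c ^+ 2 = - 1 ->
    L s t u a c = 0.
  move=> st su tu ac.
  rewrite -[RHS](@isotropic_mulmx (e s + a *: e t + c *: e u)).
    rewrite !mulmxDl -!scalemxAl !dotDl !dotDr !dotZl !dotZr.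
    by rewrite -!/(b _ _) (bC t s) (bC u s) (bC u t) /L; ring.
  rewrite !dotDl !dotDr !dotZl !dotZr !dot_delta !eqxx.
  rewrite !(eq_sym t s) !(eq_sym u) (negPf st) (negPf su) (negPf tu) /=.
  by transitivity (1 + (a ^+ 2 + c ^+ 2)); [ring | rewrite ac subrr].
have diag s t u : s != t -> s != u -> t != u -> b s t = 0 /\
    b s s + al ^+ 2 * b t t + be ^+ 2 * b u u = 0.
  move=> st su tu; have E a c := isoE s t u a c st su tu.
  have two (x : F) : 2%:R * x = 0 -> x = 0 by move/eqP;
    rewrite mulf_eq0 (negPf two0) /= => /eqP.
  split.
    suff: al * b s t = 0 by move/eqP; rewrite mulf_eq0 (negPf al0) /= => /eqP.
    (* Summing [L] over the four sign choices, weighted by the sign of [al], leaves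
       [8 * al * b s t]; the unweighted sum used next leaves four times the diagonal terms. *)
    do 3!apply: (two).
    transitivity (L s t u al be + L s t u al (- be) - L s t u (- al) be - L s t
      u (- al) (- be)).
      by rewrite /L; ring.
    by rewrite !E ?sqrrN // !subr0 addr0.
  do 2!apply: (two).
  transitivity (L s t u al be + L s t u al (- be) + L s t u (- al) be + L s t u
    (- al) (- be)).
    by rewrite /L; ring.
  by rewrite !E ?sqrrN // !addr0.
have off s t : s != t -> b s t = 0.
  move=> st; have [u] := @Z7_notin [:: s; t] isT.
  rewrite !inE negb_or !(eq_sym u) => /andP[su tu].
  by have [] := diag s t u st su tu.
have dg (s t : 'Z_7) : b s s = b t t.
  have [->//|st] := eqVneq s t.
  have [u] := @Z7_notin [:: s; t] isT; rewrite !inE negb_or => /andP[us ut].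
  have [w] := @Z7_notin [:: s; t; u] isT;
    rewrite !inE !negb_or => /and3P[ws wt wu].
  rewrite (eq_sym w u) in wu; rewrite (eq_sym w s) in ws;
    rewrite (eq_sym w t) in wt.
  have [_ Es] := diag u s w us wu ws; have [_ Et] := diag u t w ut wu wt.
  have: al ^+ 2 * (b s s - b t t) = 0.
    transitivity (b u u + al ^+ 2 * b s s + be ^+ 2 * b w w
      - (b u u + al ^+ 2 * b t t + be ^+ 2 * b w w)); first by ring.
    by rewrite Es Et subr0.
  by move/eqP; rewrite mulf_eq0 expf_eq0 (negPf al0) /= subr_eq0 => /eqP.
have SE : M *m M^T = (b 0 0)%:M.
  apply/matrixP => s t; transitivity (b s t); last first.
    rewrite [RHS]mxE; have [<-|/off//] := eqVneq s t.
    by rewrite mulr1n (dg s 0).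
  rewrite /b -!rowE /dot [LHS]mxE; apply: eq_bigr => u _.
  by rewrite !mxE.
exists (b 0 0) => //; apply/eqP => b0.
have: M *m M^T \in unitmx by rewrite unitmx_mul unitmx_tr uM.
by rewrite SE b0 unitmxE det_scalar expr0n unitr0.
Qed.

(* [ad (v M)] kills [(v M)^T] by alternation, hence [ad v] kills
   [N M^T v^T]; for [v] anisotropic the kernel of [ad v] is the line of [v]. *)
Lemma cross_semisimilarity_eq : exists2 c, c != 0 & N = c *: M.
Proof.
have [c c0 MMT] := mulmx_tr_scalar.
have [|k NMT] := @scalar_of_eigen (N *m M^T).
  move=> v v0; exists ((dot v v)^-1 * (v *m (N *m M^T) *m v^T) 0 0).
  have vMM : ad (v *m M) *m (v *m M)^T = 0.
    apply: row_mulmx_inj => w; rewrite mulmxA mul_ad mulmx0 dot_mxE.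
    by rewrite dotC dot_cross raddf0.
  (* The second factor [ad v] brings in [ad_sqr]: any column [y] killed by [ad v] satisfies
     [dot v v *: y = v^T *m v *m y], a multiple of [v^T]. *)
  have: ad v *m (ad v *m ((N *m M^T) *m v^T)) = 0.
    have -> : ad v *m (N *m M^T *m v^T) = 0; last by rewrite mulmx0.
    by rewrite !mulmxA -ad_mulmx -!mulmxA -trmx_mul vMM mulmx0.
  rewrite mulmxA ad_sqr mulmxBl mul_scalar_mx => /eqP;
    rewrite subr_eq0 => /eqP h.
  have vv : v^T *m v *m (N *m M^T *m v^T) = (v *m (N *m M^T) *m v^T) 0 0 *: v^T.
    by rewrite -mul_mx_scalar -mx11_scalar !mulmxA.
  by rewrite -scalerA -vv h scalerA mulVf // scale1r.
have uMT : M^T \in unitmx by rewrite unitmx_tr.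
have MN : N = (k / c) *: M.
  apply: (can_inj (mulmxK uMT)); rewrite -scalemxAl MMT NMT.
  by rewrite scale_scalar_mx divfK.
exists (k / c) => //; apply: contraTneq uN => kc0.
by rewrite MN kc0 scale0r -(raddf0 (@scalar_mx F 7)) unitmxE det_scalar expr0n
  unitr0.
Qed.

End Semisimilarity.

(** Applying [M] to [cross_cross] and comparing gives [eqv]. A nonzero coefficient on its right
    would put every [x] on the line of [v]; so it vanishes, and then so does the left one. *)
Lemma cross_automorphism_dot M : M \in unitmx ->
  (forall v w, cross (v *m M) (w *m M) = cross v w *m M) ->
  forall v w, dot (v *m M) (w *m M) = dot v w.
Proof.
move=> uM crossM v w.
have [->|v0] := eqVneq v 0.
  by rewrite mul0mx -(scale0r (0 : 'rV[F]_7)) !dotZl !mul0r.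
have eqv x : (dot (v *m M) (x *m M) - dot v x) *: v =
    (dot (v *m M) (v *m M) - dot v v) *: x.
  apply: (can_inj (mulmxK uM)); rewrite -!scalemxAl !scalerBl.
  have h := cross_cross (v *m M) (x *m M).
  rewrite !crossM cross_cross mulmxBl -!scalemxAl in h.
  rewrite -[dot _ _ *: _ in LHS](subrK (dot (v *m M) (v *m M) *: (x *m M))) -h.
  by rewrite [_ + _ *: (x *m M)]addrC -!addrA; congr (_ + _);
    rewrite addrC subrK.
have vv : dot (v *m M) (v *m M) = dot v v.
  apply/eqP; rewrite -subr_eq0; apply/negPn/negP => d0.
  have: (1%:M <= v)%MS.
    apply/row_subP => i; set x := row i _; rewrite -[x](scalerK d0) -eqv.
    by rewrite scalerA scalemx_sub.
  by move/mxrankS; rewrite mxrank1 leqNgt => /negP[];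
    apply: leq_trans (rank_leq_row v) _.
have := eqv w; rewrite vv subrr scale0r => /eqP.
by rewrite scaler_eq0 (negPf v0) orbF subr_eq0 => /eqP.
Qed.

(** An octonion automorphism fixes 1, so imaginary parts can be compared. Conversely [M] is extended
    by 1 on the real line, and real parts agree because [M] preserves [dot]. *)
Lemma mem_G2_7 (M : {'GL_7[F]}) :
  reflect (forall v w, cross (v *m GLval M) (w *m GLval M) =
             cross v w *m GLval M)
    (M \in G2_7 F).
Proof.
have uM : GLval M \in unitmx := valP M.
have oct1E : oct1 F = row_mx 1%:M 0.
  apply/rowP => j; rewrite mxE eqxx /=; case: (split_ordP j) => {}j ->.
    by rewrite row_mxEl mxE (ord1 j) !eqxx.
  by rewrite row_mxEr mxE eq_rlshift.
have octmul0 v w : octmul (row_mx 0 v) (row_mx 0 w) =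
    - dot v w *: oct1 F + row_mx 0 (cross v w).
  rewrite -(raddf0 (@scalar_mx F 1)) octmul_row_mx mul0r sub0r !scale0r !add0r
    oct1E.
  by rewrite scale_row_mx scaler0 add_row_mx add0r raddf0 addr0 scale_scalar_mx
    mulr1.
apply: (iffP idP) => [|crossM].
  rewrite inE => /existsP[g /andP[]];
    rewrite inE => /forallP gM /forallP gE v w.
  pose A : 'M[F]_(1 + 7) := GLval g.
  have {}gM (x y : 'rV[F]_(1 + 7)) : octmul x y *m A = octmul (x *m A) (y *m A).
    by apply/eqP; apply: (forallP (gM x)).
  have {}gE x : row_mx (0 : 'rV_1) x *m A = row_mx 0 (x *m GLval M).
    by apply/eqP.
  have uA : A \in unitmx := valP g.
  (* Multiplying 1 by its own preimage and applying [A] yields 1 on one side and the image of 1 on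
     the other. *)
  have g1 : oct1 F *m A = oct1 F.
    have := gM (oct1 F) (oct1 F *m invmx A).
    by rewrite oct1mul mulmxKV // octmul1.
  have := gM (row_mx 0 v) (row_mx 0 w).
  rewrite !gE !octmul0 mulmxDl -scalemxAl g1 gE.
  rewrite oct1E !scale_row_mx !scaler0 !add_row_mx !add0r => /eq_row_mx[_ ->].
  by [].
have uB : block_mx 1%:M 0 0 (GLval M) \in @unitmx F (1 + 7).
  by rewrite block_diag_mx_unit unitmx1.
rewrite inE; apply/existsP; exists (FinRing.unit _ uB).
have gE (a : F) v : row_mx a%:M v *m block_mx 1%:M 0 0 (GLval M) =
    row_mx a%:M (v *m GLval M).
  by rewrite mul_row_block !mulmx0 mulmx1 addr0 add0r.
apply/andP; split; last first.
  by apply/forallP => v; rewrite -(raddf0 (@scalar_mx F 1)); apply/eqP;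
    apply: gE.
rewrite inE; apply/forallP => x; apply/forallP => y; apply/eqP.
rewrite -[x]hsubmxK -[y]hsubmxK [lsubmx x]mx11_scalar [lsubmx y]mx11_scalar.
rewrite [GLval _]/= !octmul_row_mx !gE octmul_row_mx.
by rewrite cross_automorphism_dot // !mulmxDl -!scalemxAl crossM.
Qed.

(** Commuting with the transvections [1%:M + delta_mx i j] means commuting with the off-diagonal
    matrix units, which forces a scalar. *)
Lemma center_GLP (z : {'GL_7[F]}) :
  reflect (exists2 c, c != 0 & GLval z = c%:M) (z \in 'Z('GL_7[F])%g).
Proof.
apply: (iffP idP) => [|[c c0 zE]]; last first.
  apply/centerP; split=> [|g _]; first by rewrite inE.
  apply/val_inj; change (GLval z *m GLval g = GLval g *m GLval z).
  by rewrite zE scalar_mxC.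
case/centerP=> _ zC.
have uz : GLval z \in unitmx := valP z.
have comm i j : i != j -> GLval z *m delta_mx i j = delta_mx i j *m GLval z.
  move=> ij.
  have u1 : 1%:M + delta_mx i j \in @unitmx F 7.
    apply: (proj1 (@mulmx1_unit _ _ _ (1%:M - delta_mx i j) _)).
    rewrite mulmxBr mulmx1 mulmxDl mul1mx mul_delta_mx_0 1?eq_sym //.
    by rewrite addr0 addrK.
  have := zC (FinRing.unit _ u1); rewrite inE => /(_ isT) /(congr1 val) h.
  have {}h : GLval z *m (1%:M + delta_mx i j) =
    (1%:M + delta_mx i j) *m GLval z := h.
  by move: h; rewrite mulmxDr mulmxDl mulmx1 mul1mx => /addrI.
have entry i j k l : i != j ->
    GLval z k i * (l == j)%:R = (k == i)%:R * GLval z j l.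
  move=> /comm/matrixP/(_ k l); rewrite !mxE.
  under eq_bigr do rewrite mxE; under [in RHS]eq_bigr do rewrite mxE.
  rewrite [LHS](bigD1 i) //= [RHS](bigD1 j) //= !eqxx andbT.
  rewrite [X in _ + X]big1 => [|u /negPf->]; last by rewrite mulr0.
  by rewrite addr0 [X in _ + X]big1 => [|u /negPf->];
    rewrite ?andbF ?mul0r // addr0.
have zE : GLval z = (GLval z 0 0)%:M.
  apply/matrixP => i j; rewrite [RHS]mxE.
  have [<-|ij] := eqVneq i j; last first.
    by have := entry j i i i; rewrite eq_sym ij eqxx mulr1 => -> //;
      rewrite (negPf ij) mul0r.
  have [->//|i0] := eqVneq i 0.
  by have := entry i 0 i 0 i0; rewrite !eqxx mulr1 mul1r.
exists (GLval z 0 0) => //; apply: contraTneq uz => z0.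
by rewrite zE z0 unitmxE det_scalar expr0n unitr0.
Qed.

(* The condition says that [M] stabilises the kernel of the map from the
   exterior square of [V] onto [V] given by the cross product. *)
Lemma mem_ZG2_7 (M : {'GL_7[F]}) :
  reflect (exists2 N, N \in unitmx &
      forall v w, cross (v *m GLval M) (w *m GLval M) = cross v w *m N)
    (M \in 'Z('GL_7[F]) * G2_7 F)%g.
Proof.
apply: (iffP idP) => [/mulsgP[z g /center_GLP[c c0 zE] /mem_G2_7 crossg ->]|].
  exists (c ^+ 2 *: GLval g).
    by rewrite unitmxZ ?unitfE ?expf_neq0 //; exact: (valP g).
  have -> : GLval (z * g)%g = c *: GLval g.
    by rewrite -mul_scalar_mx -zE.
  by move=> v w; rewrite -!scalemxAr crossZZ crossg.
case=> N uN crossMN.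
have [c c0 NE] := cross_semisimilarity_eq (valP M) uN crossMN.
have uc : c%:M \in @unitmx F 7 by rewrite unitmxE det_scalar unitrX ?unitfE.
pose z : {'GL_7[F]} := FinRing.unit _ uc.
rewrite -(mulKVg z M) mem_mulg //; first by apply/center_GLP; exists c.
have zM : GLval (z^-1 * M)%g = c^-1 *: GLval M.
  change (invmx c%:M *m GLval M = c^-1 *: GLval M).
  by rewrite invmx_scalar mul_scalar_mx.
apply/mem_G2_7 => v w; rewrite zM -!scalemxAr crossZZ crossMN NE.
by rewrite -scalemxAr scalerA mulrVK ?unitfE.
Qed.

End Similarity.

(* Up to sign, [i_t i_u] is the third point on the line of the Fano plane
   through [t] and [u], the lines being [{k, k+1, k+3}]; so negating the [i_t]
   off a line is an octonion automorphism. *)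
Definition off_line (t : 'Z_7) : bool := t \notin [:: 0; 1; 3%:R].

(** Each pair completes [t] to a Fano line, which meets the line [{0, 1, 3}] in one or three points
    and so has an even number of points off it. *)
Lemma off_line_add t :
  [/\ off_line (t + 1%:R) (+) off_line (t + 3%:R) = off_line t,
      off_line (t + 2%:R) (+) off_line (t + 6%:R) = off_line t &
      off_line (t + 4%:R) (+) off_line (t + 5%:R) = off_line t].
Proof. by case: t => [[|[|[|[|[|[|[|]]]]]]]] // ?; split. Qed.

Lemma off_line_sub s t :
  ~~ off_line (t - s) -> ~~ off_line (t - (s - 1)) -> t = s.
Proof.
have -> : t - (s - 1) = t - s + 1 by rewrite opprB addrA addrAC.
move=> h1 h2; apply/eqP; rewrite -subr_eq0; move: (t - s) h1 h2.
by case=> [[|[|[|[|[|[|[|]]]]]]]] // ?.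
Qed.

Definition fano_pairs : seq ('Z_7 * 'Z_7) :=
  [:: (1%:R, 3%:R); (2%:R, 6%:R); (4%:R, 5%:R)].

(** The three pairs have differences 2, 4 and 1, which together with their negatives are all the
    nonzero residues modulo 7. *)
Lemma fano_pairsP (s t : 'Z_7) : s != t ->
  exists u, exists2 ij, ij \in fano_pairs &
    (s, t) = (u + ij.1, u + ij.2) \/ (t, s) = (u + ij.1, u + ij.2).
Proof.
rewrite eq_sym -subr_eq0 => st.
suff /hasP[ij ijF /orP[/eqP d|/eqP d]] :
    has (fun ij => (t - s == ij.2 - ij.1) || (t - s == ij.1 - ij.2)) fano_pairs.
- exists (s - ij.1), ij => //; left; congr pair; first by rewrite subrK.
  by rewrite addrAC -addrA -d addrC subrK.
- exists (s - ij.2), ij => //; right; congr pair; last by rewrite subrK.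
  by rewrite addrAC -addrA -d addrC subrK.
by case: (t - s) st => [[|[|[|[|[|[|[|]]]]]]]].
Qed.

(** * Monomial automorphisms: cyclic shifts and sign changes *)

Section MonomialAutomorphisms.

Variable F : finFieldType.

Definition shift_mx (k : 'Z_7) : 'M[F]_7 :=
  \matrix_(s < 7, t < 7) (t == s + k :> 'Z_7)%:R.

Definition sign_mx (k : 'Z_7) : 'M[F]_7 :=
  diag_mx (\row_(t < 7) (-1) ^+ off_line ((t : 'Z_7) - k)).

Lemma mul_shift_mx k (v : 'rV[F]_7) (t : 'Z_7) :
  (v *m shift_mx k) 0 t = v 0 (t - k).
Proof.
rewrite mxE (bigD1 (t - k : 'Z_7)) //= mxE subrK eqxx mulr1 big1 ?addr0 //.
by move=> s st; rewrite mxE -subr_eq eq_sym (negPf st) mulr0.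
Qed.

Lemma mul_sign_mx k (v : 'rV[F]_7) (t : 'Z_7) :
  (v *m sign_mx k) 0 t = (-1) ^+ off_line (t - k) * v 0 t.
Proof. by rewrite mul_mx_diag !mxE mulrC. Qed.

Lemma shift_mx_unit k : shift_mx k \in unitmx.
Proof.
apply: (proj1 (@mulmx1_unit _ _ _ (shift_mx (- k)) _));
  apply: row_mulmx_inj => w.
by apply/rowP => t; rewrite mulmx1 mulmxA !mul_shift_mx opprK addrK.
Qed.

Lemma sign_mx_unit k : sign_mx k \in unitmx.
Proof.
apply: (proj1 (@mulmx1_unit _ _ _ (sign_mx k) _)); apply: row_mulmx_inj => w.
by apply/rowP => t; rewrite mulmx1 mulmxA !mul_sign_mx mulrA -expr2 sqrr_sign
  mul1r.
Qed.

Lemma delta_shift_mx k (s : 'Z_7) :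
  (delta_mx 0 s : 'rV[F]_7) *m shift_mx k = delta_mx 0 (s + k : 'Z_7).
Proof. by apply/rowP => t; rewrite mul_shift_mx !mxE subr_eq. Qed.

Lemma delta_sign_mx k (s : 'Z_7) :
  (delta_mx 0 s : 'rV[F]_7) *m sign_mx k =
    (-1) ^+ off_line (s - k) *: delta_mx 0 s.
Proof.
apply/rowP => t; rewrite mul_sign_mx !mxE.
by have [->|] := eqVneq t s; rewrite ?mulr0.
Qed.

Lemma cross_shift_mx k (v w : 'rV[F]_7) :
  cross (v *m shift_mx k) (w *m shift_mx k) = cross v w *m shift_mx k.
Proof.
apply/rowP => u; rewrite mul_shift_mx !crossE /cross_coord /minor !mul_shift_mx.
by rewrite !(addrAC (u : 'Z_7) _ (- k)).
Qed.

Lemma cross_sign_mx k (v w : 'rV[F]_7) :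
  cross (v *m sign_mx k) (w *m sign_mx k) = cross v w *m sign_mx k.
Proof.
apply/rowP => u; rewrite mul_sign_mx !crossE /cross_coord /minor !mul_sign_mx.
rewrite !(addrAC (u : 'Z_7) _ (- k)).
have [E1 E2 E3] := off_line_add ((u : 'Z_7) - k).
rewrite 2!mulrDr -{1}E1 -{1}E2 -{1}E3 !signr_addb.
have minorZ (a b x y z t : F) : a * x * (b * y) - b * z * (a * t) =
    a * b * (x * y - z * t).
  by ring.
by rewrite !minorZ.
Qed.

End MonomialAutomorphisms.

Local Open Scope group_scope.

(** * Lower bound on the derived subgroup *)

Section DerivedSubgroupBound.

Variables (p : nat) (gT : finGroupType) (P : {group gT}).
Hypotheses (p_pr : prime p) (p_odd : odd p).
Hypothesis exp_P : forall x, x \in P -> x ^+ p = 1.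
Hypothesis Phi_central : 'Phi(P) \subset 'Z(P).
Hypothesis der_central : P^`(1) \subset 'Z(P).
Hypothesis nabelian_P : ~~ abelian P.

Variable pi : gT -> 'rV['F_p]_7.
Hypothesis piM : {in P &, forall x y, pi (x * y) = (pi x + pi y)%R}.
Hypothesis pi_surj : forall v, exists2 x, x \in P & pi x = v.
Hypothesis pi_ker : forall x, x \in P -> pi x = 0%R -> x \in 'Phi(P).
Hypothesis pi_lift : forall M : 'M['F_p]_7, M \in unitmx ->
  (forall v w, cross (v *m M) (w *m M) = cross v w *m M)%R ->
  exists2 a, a \in Aut P & {in P, forall x, pi (a x) = (pi x *m M)%R}.

Definition signg (b : bool) (x : gT) := if b then x^-1 else x.

Lemma pi1 : pi 1 = 0%R.
Proof. by apply: (addrI (pi 1)); rewrite -piM ?mulg1 ?addr0. Qed.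

Lemma piV x : x \in P -> pi x^-1 = (- pi x)%R.
Proof.
by move=> Px; apply: (addrI (pi x)); rewrite -piM ?groupV // mulgV pi1 subrr.
Qed.

Lemma comm_central : {in P &, forall x y, [~ x, y] \in 'Z(P)}.
Proof. by move=> x y Px Py; rewrite (subsetP der_central) ?mem_commg. Qed.

Lemma commMl : {in P & &, forall x y z, [~ x * y, z] = [~ x, z] * [~ y, z]}.
Proof.
move=> x y z Px Py Pz; rewrite commMgJ; congr (_ * _).
have /centerP[_ cP] := comm_central Px Pz.
by rewrite conjgE cP // mulKg.
Qed.

(** Elements with equal image under [pi] differ by an element of the Frattini subgroup, which is
    central. *)
Lemma comm_piE x y z : x \in P -> y \in P -> z \in P ->
  pi x = pi y -> [~ x, z] = [~ y, z].
Proof.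
move=> Px Py Pz xy; rewrite -{1}[x](mulgKV y) commMl ?groupM ?groupV //.
suff /commgP/eqP->: commute (x * y^-1) z by rewrite mul1g.
suff /centerP[_ xyC] : x * y^-1 \in 'Z(P) by apply: xyC.
by rewrite (subsetP Phi_central) // pi_ker ?groupM ?groupV // piM ?groupV //
  piV // xy subrr.
Qed.

Lemma comm_pi_sign (b : bool) x y z : x \in P -> y \in P -> z \in P ->
  pi x = ((-1) ^+ b *: pi y)%R -> [~ x, z] = signg b [~ y, z].
Proof.
move=> Px Py Pz; case: b => xy; last by apply: comm_piE; rewrite // xy scale1r.
rewrite (@comm_piE x y^-1) ?groupV //; last by rewrite piV // xy expr1 scaleN1r.
by apply: (mulgI [~ y, z]); rewrite -commMl ?groupV // !mulgV comm1g.
Qed.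

Lemma signgV b x : (signg b x)^-1 = signg b x^-1.
Proof. by case: b. Qed.

Lemma comm_pi_sign2 (b b' : bool) x x' y y' :
  x \in P -> y \in P -> x' \in P -> y' \in P ->
  pi x = ((-1) ^+ b *: pi y)%R -> pi x' = ((-1) ^+ b' *: pi y')%R ->
  [~ x, x'] = signg (b (+) b') [~ y, y'].
Proof.
move=> Px Py Px' Py' xy xy';
  rewrite (comm_pi_sign Px Py Px' xy) -[[~ y, x']]invg_comm.
rewrite (comm_pi_sign Px' Py' Py xy') signgV invg_comm.
by case: b b' {xy xy'} => [] [] //=; rewrite invgK.
Qed.

(** The product [m] of powers of lifts, with the coordinates of [pi w] as exponents, agrees with [w]
    modulo the Frattini subgroup, whose elements are non-generators. *)
Lemma generate_lifts (x : 'Z_7 -> gT) : (forall t, x t \in P) ->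
  (forall t, pi (x t) = delta_mx 0 t) -> <<[set x t | t : 'Z_7]>> = P.
Proof.
move=> Px pix; set X := [set x t | t : 'Z_7].
have sXP : X \subset P by apply/subsetP => _ /imsetP[t _ ->].
have sgP : <<X>> \subset P by rewrite gen_subG.
apply: Phi_nongen; apply/eqP; rewrite eqEsubset join_subG Phi_sub sXP /=.
apply/subsetP => w Pw.
pose m := \prod_(t : 'Z_7) x t ^+ (pi w 0%R t : 'F_p).
have [mX mw]: m \in <<X>> /\ pi m = pi w.
  rewrite [in RHS](row_sum_delta (pi w)) /m.
  pose K y (v : 'rV['F_p]_7) := y \in <<X>> /\ pi y = v.
  apply: (big_rec2 K) => [|t y v _ [yX <-]]; first by split;
    rewrite ?group1 ?pi1.
  have xX : x t \in <<X>> by rewrite mem_gen // imset_f.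
  split; first by rewrite groupM ?groupX.
  rewrite piM ?groupX ?(subsetP sgP) //; congr (_ + _)%R.
  have -> n : pi (x t ^+ n) = (pi (x t) *+ n)%R.
    elim: n => [|n IH]; first by rewrite expg0 mulr0n pi1.
    by rewrite expgS mulrS piM ?groupX // IH.
  by rewrite pix -scaler_nat natr_Zp.
have Pm : m \in P := subsetP sgP m mX.
rewrite -[w](mulgKV m) groupM //; last first.
  by have /subsetP-> : <<X>> \subset 'Phi(P) <*> X by rewrite gen_subG
    joing_subr.
apply: (subsetP (joing_subl _ _)).
by rewrite pi_ker ?groupM ?groupV // piM ?groupV // piV // mw subrr.
Qed.

Lemma der1_lower_bound : (p ^ 7 <= #|P^`(1)|)%N.
Proof.
have lift (t : 'Z_7) : exists y, y \in P /\ pi y = delta_mx 0 t.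
  by have [y] := pi_surj (delta_mx 0 t); exists y.
have [x xE] := fin_all_exists lift.
have Px t : x t \in P by case: (xE t).
have pix t : pi (x t) = delta_mx 0 t by case: (xE t).
have /existsP[s /existsP[t cst]] : [exists s, exists t, [~ x s, x t] != 1].
  apply: contraNT nabelian_P => /existsPn noncomm.
  rewrite -(generate_lifts Px pix) abelian_gen;
    apply/centsP => _ /imsetP[s _ ->] _ /imsetP[t _ ->].
  by apply/commgP; have /existsPn/(_ t)/negPn := noncomm s.
have st : s != t by apply: contraNneq cst => ->; rewrite commgg.
have [u [[i j] ijF cij]] : exists u, exists2 ij,
    ij \in fano_pairs & [~ x (u + ij.1)%R, x (u + ij.2)%R] != 1.
  have [u [ij ijF [[e1 e2]|[e1 e2]]]] := fano_pairsP st; exists u, ij;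
    rewrite -?e1 -?e2 //.
  by rewrite -invg_comm invg_eq1.
(* With the offsets [(i, j)] fixed, a lifted sign change sends [z k] to itself or its inverse
   according to [off_line (k - k0)], so distinct [k] carry distinct weights. *)
pose z k := [~ x (k + i)%R, x (k + j)%R].
(* A lift of the shift by [k - u] carries the nontrivial commutator at [u] to [z k]. *)
have z_neq1 k : z k != 1.
  have [a Aa pia] := pi_lift (shift_mx_unit _ (k - u)%R) (cross_shift_mx
    (k - u)%R).
  have aP y : y \in P -> a y \in P by move=> Py; rewrite (Aut_closed Aa).
  have pixa m : pi (a (x (u + m)%R)) = pi (x (k + m)%R).
    by rewrite pia // !pix delta_shift_mx addrAC [(u + (k - u))%R]addrC subrK.
  apply: contraNneq cij => zk1.
  have : a [~ x (u + i)%R, x (u + j)%R] = z k.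
    rewrite -(autmE Aa) morphR ?Px //= autmE.
    by rewrite (@comm_pi_sign2 false false _ _ (x (k + i)%R) (x (k + j)%R)) ?aP
      // scale1r pixa.
  by rewrite zk1 => h; rewrite -(inj_eq (@perm_inj _ a)) h -(autmE Aa) morph1.
have zP k : z k \in P^`(1) by rewrite mem_commg.
have zZ k : z k \in 'Z(P) := subsetP der_central _ (zP k).
have order_p y : y \in P -> y != 1 -> #[y] = p.
  by move=> Py y1; apply: nt_prime_order => //; apply: exp_P.
have zPp k : z k \in P by rewrite groupR.
have ZC y w : y \in 'Z(P) -> w \in 'Z(P) -> y * w = w * y.
  by case/setIP=> Py _ /centerP[_ ->].
(* [y |-> y * a y] kills [z k] if the sign change [a] inverts it. Two lines
   of the Fano plane meet in a single point, so two such maps isolate one [k]. *)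
have fold k0 : exists D : gT -> gT, [/\ {in 'Z(P) &, {morph D : y w / y * w}},
    {in 'Z(P), forall y, D y \in 'Z(P)} &
    forall k, D (z k) = if off_line (k - k0)%R then 1 else z k ^+ 2].
  have [a Aa pia] := pi_lift (sign_mx_unit _ k0) (cross_sign_mx k0).
  have aZ y : y \in 'Z(P) -> a y \in 'Z(P).
    move=> Zy; have /charP[_ /(_ _ (injm_autm Aa) (im_autm Aa)) aZP] :=
      center_char P.
    by rewrite -(autmE Aa) -aZP mem_morphim ?(subsetP (center_sub P)).
  exists (fun y => y * a y); split=> [y w Zy Zw|y Zy|k]; last 1 first.
  - have pixa m : pi (a (x m)) = ((-1) ^+ off_line (m - k0) *: pi (x m))%R.
      by rewrite pia // pix delta_sign_mx.
    have aP y : y \in P -> a y \in P by move=> Py; rewrite (Aut_closed Aa).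
    suff az : a (z k) = signg (off_line (k - k0)) (z k).
      by rewrite /= az; case: off_line; rewrite /= ?mulgV ?expg2.
    rewrite {1}/z -(autmE Aa) morphR ?Px //= autmE.
    rewrite (comm_pi_sign2 _ _ _ _ (pixa _) (pixa _)) ?aP // -/(z k).
    rewrite !(addrAC k _ (- k0))%R; have [E1 E2 E3] := off_line_add (k - k0)%R.
    by congr signg; move: ijF; rewrite !inE => /or3P[] /eqP[-> ->].
  - have aM : a (y * w) = a y * a w by rewrite -(autmE Aa) morphM ?(subsetP
    (center_sub P)).
    by rewrite aM -!mulgA; congr (_ * _); rewrite !mulgA; congr (_ * _);
      rewrite ZC // aZ.
  - by rewrite groupM // aZ.
(* The exponent 4 arises because each of the two folds squares the surviving commutator. *)
have isolate s0 : exists2 E : gT -> gT, {in 'Z(P) &, {morph E : y w / y * w}} &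
    forall k, E (z k) = if k == s0 then z k ^+ 4 else 1.
  have [D [DM DZ Dz]] := fold s0; have [D' [DM' DZ' Dz']] := fold (s0 - 1)%R.
  exists (D' \o D) => [y w Zy Zw|k] /=; first by rewrite DM // DM' // DZ.
  have D'1 : D' 1 = 1 by apply: (mulgI (D' 1)); rewrite -DM' ?group1 // !mulg1.
  rewrite Dz; case: ifPn => [off1|on1].
    by case: eqP => // ks; rewrite ks subrr in off1.
  rewrite expg2 DM' // Dz'; case: ifPn => [off2|on2]; last first.
    by rewrite (off_line_sub on1 on2) eqxx -expgD.
  case: eqP => [ks|_]; last by rewrite mulg1.
  by rewrite ks opprB addrC subrK in off2.
(* The map isolating [s0] reads off [n s0] as an exponent of [z s0 ^+ 4], which has order [p]
   because [p] is odd. This gives [p ^ 7] distinct products. *)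
have inj : injective (fun n : {ffun 'Z_7 -> 'I_p} => \prod_k z k ^+ n k).
  move=> n m /= nm; apply/ffunP => s0; have [E EM Ez] := isolate s0.
  have E1 : E 1 = 1 by apply: (mulgI (E 1)); rewrite -EM ?group1 // !mulg1.
  have Eprod (r : {ffun 'Z_7 -> 'I_p}) : E (\prod_k z k ^+ r k) =
      (z s0 ^+ 4) ^+ r s0.
    have EX k q : E (z k ^+ q) = E (z k) ^+ q.
      by elim: q => [|q IH]; rewrite ?expg0 // !expgS EM ?groupX // IH.
    transitivity (\prod_k E (z k ^+ r k)).
      pose K y w := y \in 'Z(P) /\ E y = w.
      suff [] : K (\prod_k z k ^+ r k) (\prod_k E (z k ^+ r k)) by [].
      apply: (big_rec2 K) => [|k y w _ [Zy <-]]; first by split;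
        rewrite ?group1.
      by split; [rewrite groupM ?groupX | rewrite EM ?groupX].
    have Ek k : E (z k ^+ r k) = if k == s0 then (z s0 ^+ 4) ^+ r s0 else 1.
      by rewrite EX Ez; case: eqP => [->|] //; rewrite expg1n.
    under eq_bigr do rewrite Ek; rewrite -big_mkcond /=.
    by rewrite big_pred1_eq.
  have z4 : #[z s0 ^+ 4] = p.
    apply: (order_p); first by rewrite groupX.
    rewrite -order_dvdn order_p //.
    apply: contraL p_odd; rewrite (Euclid_dvdX 2 2) // andbT dvdn_prime2 //.
    by move/eqP->.
  have := congr1 E nm; rewrite !Eprod => /eqP; rewrite eq_expg_mod_order z4.
  by rewrite !modn_small ?ltn_ord // => /eqP/val_inj.
have <- : #|[set: {ffun 'Z_7 -> 'I_p}]| = (p ^ 7)%N by rewrite cardsT card_ffun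
  !card_ord.
rewrite -(card_imset _ inj); apply: subset_leq_card;
  apply/subsetP => _ /imsetP[n _ ->].
by apply: group_prod => k _; rewrite groupX.
Qed.

End DerivedSubgroupBound.

(** * From the hypotheses on the group to the bound on its order *)

Lemma Phi_eq_der1 (gT : finGroupType) (P : {group gT}) (p : nat) :
  p.-group P -> (exponent P %| p)%N -> 'Phi(P) = P^`(1).
Proof.
move=> pP eP; rewrite (Phi_joing pP) (MhoE 1 pP) expn1.
suff -> : <<[set x ^+ p | x in P]>> = 1 by rewrite joingG1.
apply/trivgP; rewrite gen_subG; apply/subsetP => _ /imsetP[x Px ->].
by rewrite inE (exponentP eP).
Qed.

Lemma class2_der1_central (gT : finGroupType) (P : {group gT}) (p : nat) :
  p.-group P -> (nil_class P <= 2)%N -> P^`(1) \subset 'Z(P).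
Proof.
move=> /pgroup_nil nP /(lcn_nil_classP 2 nP) L3.
by rewrite subsetI der_sub; apply/commG1P; rewrite -lcn2 -lcnSn L3.
Qed.

Lemma order_lower_bound (p : nat) (gT : finGroupType) (P : {group gT}) :
  prime p -> odd p -> class2_rank7_exponent_p_inducing_ZG2 p P ->
  (p ^ 14 <= #|P|)%N.
Proof.
move=> p_pr p_odd [pP cP _ eP [f [isof /imsetP[g _ indE]]]].
have F_odd : odd #|'F_p| by rewrite card_Fp.
have PhiE : 'Phi(P) = P^`(1) by rewrite (@Phi_eq_der1 _ _ p) ?eP.
have der_central : P^`(1) \subset 'Z(P) by apply: (class2_der1_central pP);
  rewrite cP.
have nPhi x : x \in P -> x \in 'N('Phi(P)).
  by apply: subsetP; apply: normal_norm; apply: Phi_normal.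
have qP x : x \in P -> coset 'Phi(P) x \in P / 'Phi(P) by move=> Px;
  rewrite mem_quotient.
(* The induced group is only conjugate, by [g], to the given one; changing basis by the inverse of
   [g] absorbs this. *)
pose pi x : 'rV['F_p]_7 := (f (coset 'Phi(P) x) *m invmx (GLval g))%R.
have ug : GLval g \in unitmx := valP g.
have cPhi : (p ^ 7 <= #|P^`(1)|)%N.
  apply: (@der1_lower_bound p gT P p_pr p_odd _ _ der_central _ pi).
  - by move=> x Px; rewrite -eP expg_exponent.
  - by rewrite PhiE.
  - by rewrite -nil_class1 cP.
  - move=> x y Px Py; rewrite /pi morphM ?nPhi // morphM ?qP //.
    by rewrite -mulmxDl.
  - move=> v; have: (v *m GLval g)%R \in f @* (P / 'Phi(P)) by rewrite (isom_im
    isof) inE.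
    case/morphimP=> _ _ /morphimP[x _ Px ->] vE; exists x => //.
    by rewrite /pi -vE mulmxK.
  - move=> x Px /(congr1 (mulmx^~ (GLval g)));
    rewrite /pi mulmxKV // mul0mx => fx0.
    apply: coset_idr; rewrite ?nPhi //; apply/eqP.
    by rewrite -(morph_injm_eq1 (isom_inj isof)) ?qP //; apply/eqP.
  - move=> M uM crossM.
    pose m : {'GL_7['F_p]} := FinRing.unit _ uM.
    have : m ^ g \in induced_group f.
      rewrite indE memJ_conjg; apply/(mem_ZG2_7 F_odd); exists M => //.
    rewrite inE => /existsP[a /andP[Aa /'forall_implyP aE]];
      exists a => // x Px.
    rewrite /pi (eqP (aE x Px)).
    have -> : GLval (m ^ g) = (invmx (GLval g) *m (M *m GLval g))%R by [].
    by rewrite !mulmxA mulmxK.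
rewrite -(Lagrange (Phi_sub P)) -card_quotient; last by apply: normal_norm;
  apply: Phi_normal.
rewrite (card_isog (isom_isog _ _ isof)) // cardsT card_mx card_Fp // mul1n.
by rewrite (expnD p 7 7) leq_mul //= PhiE.
Qed.

Local Close Scope group_scope.
Local Open Scope ring_scope.

(** * The group on pairs of vectors twisted by the cross product *)

Section CrossGroup.

Variable F : finFieldType.

Definition cross_group : Type := ('rV[F]_7 * 'rV[F]_7)%type.
HB.instance Definition _ := Finite.copy cross_group ('rV[F]_7 * 'rV[F]_7)%type.

Definition cg_mul (x y : cross_group) : cross_group :=
  (x.1 + y.1, x.2 + y.2 + cross x.1 y.1).
Definition cg_one : cross_group := (0, 0).
Definition cg_inv (x : cross_group) : cross_group := (- x.1, - x.2).

(** A biadditive map is a 2-cocycle. *)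
Lemma cg_mulA : associative cg_mul.
Proof.
move=> x y z; rewrite /cg_mul /= crossDl crossDr addrA; congr pair.
move: (cross x.1 y.1) (cross x.1 z.1) (cross y.1 z.1) => a b c.
by apply/rowP => u; rewrite !mxE; ring.
Qed.

Lemma cg_mul1g : left_id cg_one cg_mul.
Proof. by case=> x y; rewrite /cg_mul /= cross0v !add0r addr0. Qed.

Lemma cg_mulVg : left_inverse cg_one cg_inv cg_mul.
Proof.
by case=> x y; rewrite /cg_mul /= !addNr -scaleN1r crossZl crossvv scaler0
  addr0.
Qed.

HB.instance Definition _ :=
  Finite_isGroup.Build cross_group cg_mulA cg_mul1g cg_mulVg.

End CrossGroup.

(** * Invariants and induced automorphisms of the group of order [p^14] *)

Section CrossGroupTheory.

Variables (p : nat) (p_pr : prime p) (p_odd : odd p).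
Local Notation F := 'F_p.
Local Notation G := (cross_group F).
Implicit Types x y : G.
Local Notation P := [set: G]%G.
Local Open Scope group_scope.

Lemma cg_mulE x y : x * y = ((x.1 + y.1)%R, (x.2 + y.2 + cross x.1 y.1)%R) :> G.
Proof. by []. Qed.

Lemma cg_expE x n : x ^+ n = ((x.1 *+ n)%R, (x.2 *+ n)%R) :> G.
Proof.
elim: n => [|n IH]; first by rewrite expg0 !mulr0n.
by rewrite expgS IH cg_mulE /= !mulrS -scaler_nat crossZr crossvv scaler0 addr0.
Qed.

Lemma cg_commE x y : [~ x, y] = (0%R, (cross x.1 y.1 *+ 2)%R) :> G.
Proof.
apply: (mulgI (y * x));
  rewrite -commgC !cg_mulE /= addr0 (crossC (y.1 + x.1)%R) cross0v oppr0 addr0.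
congr pair; first by rewrite addrC.
rewrite (crossC y.1); move: (cross x.1 y.1) => a.
by apply/rowP => u; rewrite !mxE; ring.
Qed.

Lemma cg_card : #|P| = (p ^ 14)%N.
Proof. by rewrite cardsT card_prod !card_mx card_Fp // mul1n -expnD. Qed.

Lemma cg_pgroup : p.-group P.
Proof. by rewrite /pgroup cg_card pnatX pnat_id. Qed.

Lemma cg_exponent : exponent P = p.
Proof.
have eP: (exponent P %| p)%N.
  apply/exponentP => x _; rewrite cg_expE.
  have pz (v : 'rV[F]_7) : (v *+ p)%R = 0%R.
    by rewrite -scaler_nat pchar_Fp_0 // scale0r.
  by rewrite !pz.
case/primeP: p_pr => _ /(_ _ eP) /orP[|/eqP//].
rewrite -dvdn1 -trivg_exponent => /eqP P1; have := cg_card;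
  rewrite P1 cards1 => /esym/eqP.
by rewrite -[1%N](exp1n 14) eqn_exp2r // => /eqP p1; move: p_pr; rewrite p1.
Qed.

Lemma cross_delta (u : 'Z_7) :
  cross (delta_mx 0 (u + 1%:R)%R) (delta_mx 0 (u + 3%:R)%R) =
    delta_mx 0 u :> 'rV[F]_7.
Proof.
rewrite -![(u + _)%R]addrC -(delta_shift_mx _ u (1%:R)%R) -(delta_shift_mx _ u
  (3%:R)%R) cross_shift_mx.
set c := cross _ _; suff -> : c = delta_mx 0 (0 : 'Z_7)%R :> 'rV[F]_7.
  by rewrite delta_shift_mx add0r.
rewrite /c {c}; apply/rowP; case=> [[|[|[|[|[|[|[|//]]]]]]] i];
  rewrite crossE /cross_coord /minor !mxE /=;
  by rewrite !(mulr0, mul0r, mulr1, oppr0, subr0, add0r, addr0).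
Qed.

Lemma cg_fstM : {in P &, {morph (fun x : G => x.1) : x y / x * y}}.
Proof. by []. Qed.

Definition cg_fst : {morphism P >-> 'rV[F]_7} := Morphism cg_fstM.

Lemma cg_ker : 'ker cg_fst = [set x : G | x.1 == 0%R].
Proof. by apply/setP => x; rewrite !inE. Qed.

Lemma cg_ker_central : 'ker cg_fst \subset 'Z(P).
Proof.
apply/subsetP => x; rewrite cg_ker inE => /eqP x0; apply/centerP;
  split=> [|y _]; first by rewrite inE.
by apply/commgP; rewrite cg_commE x0 cross0v mul0rn.
Qed.

Lemma cg_der1 : P^`(1) = 'ker cg_fst.
Proof.
apply/eqP; rewrite eqEsubset; apply/andP; split.
  by rewrite gen_subG; apply/subsetP => _ /imset2P[x y _ _ ->];
    rewrite /= cg_ker inE cg_commE.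
apply/subsetP => x; rewrite cg_ker inE => /eqP x0.
have two0 : (2%:R != 0 :> F)%R by apply: two_neq0; rewrite card_Fp.
pose K (y : G) (v : 'rV[F]_7) := y \in P^`(1) /\ y = (0%R, v).
(* Basis vectors are cross products by [cross_delta], and commutators double cross products, so the
   coefficient is halved. *)
pose c (t : 'Z_7) : G :=
  [~ (((x.2 0%R t / 2%:R)%R *: delta_mx 0 (t + 1%:R)%R)%R, 0%R) : G,
   (delta_mx 0 (t + 3%:R)%R, 0%R) : G].
have [y1 yE] : K (\prod_t c t) (\sum_t x.2 0 t *: delta_mx 0 t)%R.
  apply: (big_rec2 K) => [|t y v _ [y1 yv]]; first by split; rewrite ?group1.
  have ct : c t \in P^`(1) by rewrite mem_commg ?inE.
  have cE : c t = (0%R, (x.2 0 t *: delta_mx 0 t)%R).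
    by rewrite /c cg_commE /= crossZl cross_delta scalerMnl -mulr_natr divfK.
  by split; [rewrite groupM | rewrite cE yv cg_mulE /= add0r cross0v addr0].
by rewrite [x]surjective_pairing x0 (row_sum_delta x.2) -yE.
Qed.

Lemma cg_Phi : 'Phi(P) = 'ker cg_fst.
Proof. by rewrite (Phi_eq_der1 cg_pgroup) ?cg_der1 // cg_exponent. Qed.

Lemma cg_nil_class : nil_class P = 2%N.
Proof.
apply/eqP; rewrite eqn_leq; apply/andP; split.
  apply/(lcn_nil_classP 2 (pgroup_nil cg_pgroup)); rewrite lcnSn lcn2 cg_der1.
  by apply/commG1P; apply: subset_trans cg_ker_central (subsetIr _ _).
rewrite ltnNge nil_class1; apply/negP => /derG1P;
  rewrite cg_der1 cg_ker => /setP P1.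
have := P1 (0%R, delta_mx 0 0%R);
  rewrite !inE eqxx => /esym /eqP [] /rowP /(_ 0%R).
by rewrite !mxE => /eqP; rewrite oner_eq0.
Qed.

(** Seven lifts of the basis generate, and the first projection maps onto an elementary abelian
    group of rank 7. *)
Lemma cg_grank : 'm(P) = 7%N.
Proof.
apply/eqP; rewrite eqn_leq; apply/andP; split.
  pose x (t : 'Z_7) : G := (delta_mx 0 t, 0%R).
  have Px t : x t \in P by rewrite inE.
  have ker y : y \in P -> y.1 = 0%R -> y \in 'Phi(P) by move=> _ y0;
    rewrite cg_Phi /= cg_ker inE y0.
  rewrite -(@generate_lifts p G P (fun y => y.1) cg_fstM ker x Px) //.
  apply: leq_trans (grank_min _) _; apply: leq_trans (leq_imset_card _ _) _.
  by rewrite card_ord.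
have imP : cg_fst @* P = [set: 'rV[F]_7].
  apply/setP => v; rewrite !inE; apply/morphimP; exists ((v, 0%R) : G);
    by rewrite ?inE.
have cV : abelian [set: 'rV[F]_7] := FinRing.zmod_abelian _.
have abV : p.-abelem [set: 'rV[F]_7].
  rewrite abelemE // cV; apply/exponentP => v _.
  by rewrite FinRing.zmodXgE -scaler_nat pchar_Fp_0 // scale0r.
apply: leq_trans (morphim_grank cg_fst (subxx _)).
rewrite imP grank_abelian // (rank_abelem abV) cardsT card_mx card_Fp // mul1n.
by rewrite pfactorK.
Qed.

(** Over a prime field every scalar is a natural multiple of 1, so additive maps are linear. *)
Lemma additive_mulmx (h : 'rV[F]_7 -> 'rV[F]_7) :
  (forall u v, h (u + v) = h u + h v)%R ->
  exists N, forall u, h u = (u *m N)%R.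
Proof.
move=> hD; exists (\matrix_(i < 7) h (delta_mx 0 i))%R => u.
have h0 : h 0%R = 0%R by apply: (addrI (h 0)); rewrite -hD !addr0.
have hZ (c : F) v : h (c *: v)%R = (c *: h v)%R.
  rewrite -[c]natr_Zp !scaler_nat; elim: (c : nat) => [|n IH];
    first by rewrite !mulr0n.
  by rewrite !mulrS hD IH.
rewrite mulmx_sum_row [in LHS](row_sum_delta u) (big_morph h hD h0).
by apply: eq_bigr => i _; rewrite rowK hZ.
Qed.

(** Given [N], the map [(v, a)] to [(v M, a N)] is an automorphism. Conversely [N] is the action on
    the pairs [(0, u)], and applying the automorphism to commutators gives the relation up to a
    factor 2, which cancels. *)
Lemma cg_Aut_lift (M : {'GL_7[F]}) :
  (M \in 'Z('GL_7[F]) * G2_7 F) =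
  [exists a in Aut P, forall x : G, (a x).1 == (x.1 *m GLval M)%R].
Proof.
have F_odd : odd #|F| by rewrite card_Fp.
have uM : GLval M \in unitmx := valP M.
have two0 := two_neq0 F_odd.
apply/(mem_ZG2_7 F_odd)/existsP => [[N uN crossMN]|[a /andP[Aa /forallP aE]]].
  pose h (x : G) : G := ((x.1 *m GLval M)%R, (x.2 *m N)%R).
  have h_inj : injective h.
    by move=> [v u] [v' u'] [/(can_inj (mulmxK uM)) -> /(can_inj (mulmxK uN))
      ->].
  exists (perm h_inj); apply/andP; split; last by apply/forallP => x;
    rewrite permE.
  rewrite inE; apply/andP; split; first by apply/subsetP => x _; rewrite inE.
  apply/morphicP => x y _ _; rewrite !permE cg_mulE /h /= cg_mulE /=.
  by rewrite !mulmxDl crossMN.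
have aM x y : a (x * y) = a x * a y by rewrite -(autmE Aa) morphM ?inE.
pose h u := (a ((0%R, u) : G)).2.
have aK u : a ((0%R, u) : G) = (0%R, h u).
  by rewrite [LHS]surjective_pairing (eqP (aE _)) /= mul0mx.
have hD u v : (h (u + v) = h u + h v)%R.
  have -> : (h (u + v) = (a (((0, u) : G) * ((0, v) : G))%g).2)%R.
    by rewrite cg_mulE /= add0r cross0v addr0.
  by rewrite aM !aK cg_mulE /= cross0v addr0.
have [N hN] := additive_mulmx hD.
exists N => [|v w].
  rewrite -row_free_unit -kermx_eq0; apply/rowV0P => u /sub_kermxP uN0.
  have : a ((0%R, u) : G) = a 1 by rewrite aK hN uN0 -(autmE Aa) morph1.
  by case/perm_inj.
have : a [~ ((v, 0%R) : G), ((w, 0%R) : G)] =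
    [~ a ((v, 0%R) : G), a ((w, 0%R) : G)].
  by rewrite -(autmE Aa) morphR ?inE.
rewrite !cg_commE !(eqP (aE _)) aK /= => [[h2]].
by apply: (scalerI two0); rewrite -hN !scaler_nat -h2 !mulr2n hD.
Qed.

(** The first projection, factored through the Frattini quotient, serves as the identification; the
    two groups then coincide, so the conjugating element is 1. *)
Lemma cg_induces : induces P ('Z('GL_7(p)) * G2_7 'F_p).
Proof.
have PN : P \subset 'N('Phi(P)) by apply: normal_norm; apply: Phi_normal.
have kerPhi : 'ker (coset 'Phi(P)) \subset 'ker cg_fst by rewrite ker_coset /=
  cg_Phi.
pose f : {morphism P / 'Phi(P) >-> 'rV[F]_7} := [morphism of factm kerPhi PN].
have fE (x : G) : f (coset 'Phi(P) x) = x.1 := factmE kerPhi PN (in_setT x).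
exists f; split.
  apply/isomP; split.
    by apply/injm_factmP; rewrite ker_coset /= cg_Phi.
  apply/setP => v; rewrite [RHS]inE; apply/morphimP.
  by exists (coset 'Phi(P) ((v, 0%R) : G)); rewrite ?mem_quotient ?inE // fE.
suff -> : induced_group f = 'Z('GL_7(p)) * G2_7 'F_p.
  by apply/imsetP; exists 1; rewrite ?inE ?conjsg1.
apply/setP => M; rewrite cg_Aut_lift inE.
apply: eq_existsb => a; congr (_ && _); apply: eq_forallb => x.
by rewrite inE !fE.
Qed.

End CrossGroupTheory.

Theorem mainTheorem2 (p : nat) (p_prime : prime p) (p_odd : odd p) :
  (exists (gT : finGroupType) (P : {group gT}),
     class2_rank7_exponent_p_inducing_ZG2 p P /\ #|P| = (p ^ 14)%N)
  /\ (forall (gT : finGroupType) (P : {group gT}),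
        class2_rank7_exponent_p_inducing_ZG2 p P -> (p ^ 14 <= #|P|)%N).
Proof.
split=> [|gT P]; last exact: order_lower_bound.
exists (cross_group 'F_p), [set: _]%G; split; last exact: cg_card.
split; [exact: cg_pgroup | exact: cg_nil_class | exact: cg_grank
       | exact: cg_exponent | exact: cg_induces].
Qed.
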